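(* Let $B$ be a finite set of Laurent monomials connected to $1$ and let $F$ be a border basis in any degree for $B$, with associated projection $\pi$ and multiplication operators $X_i$. Then the first module of syzygies of $F$, that is $\ker\partial_1\subset\mathcal{S}_1$, is generated as an $S$-module by the elements - $\rho_i(m)=x_i\,Y_{-i}[m]+Y_i[X_{-i}(m)]$, - $\phi_{i,j}(m)=x_i\,Y_j[m]-x_j\,Y_i[m]+Y_i[X_j(m)]-Y_j[X_i(m)]$, for $i\ne j\in[-n,n]^*$ and $m\in B$.
   Context: $\mathbb{K}$ is a field, $S=\mathbb{K}[x_1^{\pm1},\ldots,x_n^{\pm1}]$, $\mathcal{M}$ is the set of Laurent monomials $\mathbf{x}^{\alpha}=x_1^{\alpha_1}\cdots x_n^{\alpha_n}$, $\alpha\in\mathbb{Z}^n$. $\delta(\mathbf{x}^{\alpha})=|\alpha_1|+\cdots+|\alpha_n|$, and for $p\in S$, $\delta(p)$ is the maximum of $\delta$ over the support of $p$ ($\delta(0)=-\infty$). $x_{-i}=x_i^{-1}$ for $1\le i\le n$, $x_0=1$, $[-n,n]^*=\{-n,\ldots,n\}\setminus\{0\}$. $\langle G\rangle$ is the $\mathbb{K}$-span of $G$; $G_{\le d}$ is the set of elements of $G$ of degree $\le d$; $G_{[\le d]}=\{mf:m\in\mathcal{M},f\in G,\delta(mf)\le d\}$. For $B\subset\mathcal{M}$: $B^{\times}=B\cup\bigcup_{i\in[-n,n]^*}x_iB$, $\partial B=B^\times\setminus B$. $B$ is connected to $1$ if $1\in B$ and every $m\in B\setminus\{1\}$ is $x_im'$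 with $i\in[-n,n]^*$, $m'\in B$, $\delta(m')<\delta(m)$. Border basis. $\pi:\langle B^\times\rangle\to\langle B\rangle$ is a $\mathbb{K}$-linear projection (identity on $\langle B\rangle$) with $\delta(\pi(b))\le\delta(b)$ for all $b$; $F=\{\mathbf{x}^\alpha-\pi(\mathbf{x}^\alpha):\mathbf{x}^\alpha\in\partial B\}$; $X_i:\langle B\rangle\to\langle B\rangle$, $X_i(b)=\pi(x_ib)$ for $i\in[-n,n]^*$; $\sigma:S\to\langle B\rangle$ is the linear map with $\sigma(\mathbf{x}^\alpha)=X_1^{\alpha_1}\circ\cdots\circ X_n^{\alpha_n}(1)$, where $X_i^{\alpha_i}$ means $X_{-i}^{|\alpha_i|}$ if $\alpha_i<0$. $F$ is a border basis for $B$ in degree $d\ge2$ if the following conditions (shown equivalent in the paper) are satisfied: (i) on $\langle B\rangle_{\le d-2}$, $X_i\circ X_{-i}=\mathrm{Id}$ for $1\le i\le n$ and $X_i\circ X_j=X_j\circ X_i$ for $1\le i<j\le n$; (ii) $\sigma$ restricted to $S_{\le d}$ is a projection onto $\langle B\rangle_{\le d}$ with kernel $\langle F_{[\le d]}\rangle$; (iii) $\pi(r)=0$ for every $r\in\langle B^\times\rangle$ of the form $x_if$ ($f\in F_{\le d-1}$, $i\in[-n,n]^*$) or $x_if-x_jf'$ ($f,f'\in F_{\le d-1}$, $-n\le i<j\le n$). ''Border basis in any degree'' means border basis in degree $d$ for every $d\ge2$. Syzygies. For $i\in[-n,n]^*$ let $\psi_i:\langle B\rangle\to\langle F\rangle$,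 $\psi_i(m)=x_im-\pi(x_im)$. (The nonzero elements $\psi_i(m)$, $m\in B$, are exactly the elements of $F$.) $\mathcal{S}_1$ is the free $S$-module with basis the symbols $Y_i[m]=Y_i\otimes m$ with $i\in[-n,n]^*$, $m\in B$, $x_im\notin B$. By convention $Y_i[m]=0$ if $m\in B$ and $x_im\in B$, and $Y_i[\sum_j\lambda_jm_j]=\sum_j\lambda_jY_i[m_j]$ for $\sum_j\lambda_jm_j\in\langle B\rangle$. The $S$-linear map $\partial_1:\mathcal{S}_1\to S$ is given by $\partial_1(Y_i[m])=\psi_i(m)$; its kernel is the module of syzygies between the elements $\psi_i(m)$ of $F$. *)

(* Defs.v *)
From HB Require Import structures.
From mathcomp Require Import all_boot all_order all_algebra.
From mathcomp Require Import finmap.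
From mathcomp.multinomials Require Import monalg.

Set Implicit Arguments.
Unset Strict Implicit.
Unset Printing Implicit Defensive.

Import Order.TTheory GRing.Theory Num.Theory.

Local Open Scope fset_scope.
Local Open Scope ring_scope.

(* The R-submodule generated by G: the finite R-linear combinations of G. *)
Definition generated (R : nzRingType) (V : lmodType R) (G : V -> Prop)
    (v : V) : Prop :=
  exists r : seq (R * V),
    (forall t, t \in r -> G t.2) /\ v = \sum_(t <- r) t.1 *: t.2.

(* The R-linear map from the free module on I sending << k >> to h k. *)
HB.lock Definition linext (R : nzRingType) (I : choiceType) (V : lmodType R)
    (h : I -> V) (g : {malg R[I]}) : V :=
  \sum_(k <- msupp g) g@_k *: h k.
Arguments linext {R I V} h g.

Section LinExt.
Variables (R : nzRingType) (I : choiceType) (V : lmodType R) (h : I -> V).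

Lemma linextEw (d : {fset I}) (g : {malg R[I]}) :
  msupp g `<=` d -> linext h g = \sum_(k <- d) g@_k *: h k.
Proof.
move=> le; rewrite linext.unlock (big_fset_incl _ le) //= => k _ /mcoeff_outdom ->.
by rewrite scale0r.
Qed.

Lemma linext_is_linear : linear (linext h).
Proof.
move=> a g1 g2; set d := msupp g1 `|` msupp g2.
rewrite (@linextEw d) ?(@linextEw d g1) ?(@linextEw d g2) ?fsubsetUl
  ?fsubsetUr //; last first.
  by apply: (fsubset_trans (msuppD_le _ _)); apply: fsetSU; exact: msuppZ_le.
rewrite scaler_sumr -big_split; apply: eq_bigr => k _ /=.
by rewrite mcoeffD mcoeffZ scalerDl scalerA.
Qed.

HB.instance Definition _ :=
  GRing.isLinear.Build R {malg R[I]} V *:%R (linext h) linext_is_linear.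

Lemma linextU (c : R) (k : I) : linext h << c *g k >> = c *: h k.
Proof. by rewrite (linextEw msuppU_le) big_seq_fset1 mcoeffUU. Qed.

End LinExt.

(* The Laurent monomial x^a is identified with its exponent a : 'rV[int]_n, so
   a product of monomials is a sum of exponents.  The product below is the one
   of the group algebra K[Z^n]; monalg only multiplies over monoids without
   nontrivial units, which excludes Z^n.  The operations are locked to keep
   unification from unfolding them. *)
Definition laurent (K : fieldType) (n : nat) : Type := {malg K['rV[int]_n]}.

HB.instance Definition _ (K : fieldType) (n : nat) :=
  GRing.Zmodule.copy (laurent K n) {malg K['rV[int]_n]}.

HB.lock Definition term (K : fieldType) (n : nat) (c : K) (m : 'rV[int]_n) :
  laurent K n := << c *g m >>.
Arguments term {K n} c m.

Definition mono (K : fieldType) (n : nat) (m : 'rV[int]_n) : laurent K n :=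
  term 1 m.
Arguments mono K {n} m.

HB.lock Definition lscale (K : fieldType) (n : nat) (c : K) (p : laurent K n) :
  laurent K n := (c *: (p : {malg K['rV[int]_n]})).
Arguments lscale {K n} c p.

HB.lock Definition lmul (K : fieldType) (n : nat) (p q : laurent K n) :
  laurent K n :=
  \sum_(a <- msupp p) \sum_(b <- msupp q) term (p@_a * q@_b) (a + b).
Arguments lmul {K n} p q.

Section LaurentRing.
Variables (K : fieldType) (n : nat).
Implicit Types (p q r : laurent K n) (a b : 'rV[int]_n) (c : K).

Lemma coef_scale c p a : (lscale c p)@_a = c * p@_a.
Proof. by rewrite lscale.unlock; exact: mcoeffZ. Qed.

Lemma coef_term c a b : (term c a : laurent K n)@_b = c *+ (a == b).
Proof. by rewrite term.unlock mcoeffU. Qed.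

Lemma laurentP p q : (forall a, p@_a = q@_a) <-> p = q.
Proof. exact: malgP. Qed.

Lemma lscaleA c1 c2 p : lscale c1 (lscale c2 p) = lscale (c1 * c2) p.
Proof. by apply/laurentP => a; rewrite !coef_scale mulrA. Qed.

Lemma lscale1 : left_id 1 (@lscale K n).
Proof. by move=> p; apply/laurentP => a; rewrite coef_scale mul1r. Qed.

Lemma lscaleDr : right_distributive (@lscale K n) +%R.
Proof.
move=> c p q; apply/laurentP => a.
by rewrite coef_scale !mcoeffD !coef_scale mulrDr.
Qed.

Lemma lscaleDl p : {morph (@lscale K n)^~ p : c1 c2 / c1 + c2}.
Proof.
move=> c1 c2; apply/laurentP => a.
by rewrite mcoeffD !coef_scale mulrDl.
Qed.

HB.instance Definition _ := GRing.Zmodule_isLmodule.Build K (laurent K n)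
  lscaleA lscale1 lscaleDr lscaleDl.

Lemma term0 a : term 0 a = 0 :> laurent K n.
Proof. by apply/laurentP => b; rewrite coef_term mul0rn mcoeff0. Qed.

Lemma termD c1 c2 a : term (c1 + c2) a = term c1 a + term c2 a :> laurent K n.
Proof. by apply/laurentP => b; rewrite mcoeffD !coef_term mulrnDl. Qed.

Lemma termZ c1 c2 a : c1 *: term c2 a = term (c1 * c2) a :> laurent K n.
Proof. by apply/laurentP => b; rewrite coef_scale !coef_term mulrnAr. Qed.

Lemma msupp_term c a : msupp (term c a : laurent K n) `<=` [fset a].
Proof. by rewrite term.unlock; exact: msuppU_le. Qed.

Lemma laurentE p : p = \sum_(a <- msupp p) term p@_a a.
Proof. by rewrite term.unlock; exact: monalgE. Qed.

Lemma lmulEw (d1 d2 : {fset 'rV[int]_n}) p q :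
  msupp p `<=` d1 -> msupp q `<=` d2 ->
  lmul p q = \sum_(a <- d1) \sum_(b <- d2) term (p@_a * q@_b) (a + b).
Proof.
move=> le1 le2; rewrite lmul.unlock (big_fset_incl _ le1) /=.
  apply: eq_bigr => a _; apply: big_fset_incl => // b _ /mcoeff_outdom ->.
  by rewrite mulr0 term0.
move=> a _ /mcoeff_outdom pa; rewrite big1 // => b _.
by rewrite pa mul0r term0.
Qed.

Lemma lmulC : commutative (@lmul K n).
Proof.
move=> p q; rewrite lmul.unlock exchange_big; apply: eq_bigr => a _.
by apply: eq_bigr => b _; rewrite mulrC addrC.
Qed.

Lemma lmulDl : left_distributive (@lmul K n) +%R.
Proof.
move=> p q r; set d := msupp p `|` msupp q.
rewrite (@lmulEw d (msupp r)) ?(@lmulEw d (msupp r) p)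
  ?(@lmulEw d (msupp r) q) ?fsubsetUl ?fsubsetUr ?msuppD_le //.
rewrite -big_split; apply: eq_bigr => a _; rewrite -big_split.
by apply: eq_bigr => b _; rewrite mcoeffD mulrDl termD.
Qed.

Lemma lmulDr : right_distributive (@lmul K n) +%R.
Proof. by move=> p q r; rewrite !(lmulC p) lmulDl. Qed.

Lemma lmul0p : left_zero 0 (@lmul K n).
Proof. by move=> p; rewrite lmul.unlock msupp0 big_seq_fset0. Qed.

Lemma lmulp0 : right_zero 0 (@lmul K n).
Proof. by move=> p; rewrite lmulC lmul0p. Qed.

Lemma lmulUU c1 c2 a b : lmul (term c1 a) (term c2 b) = term (c1 * c2) (a + b).
Proof.
rewrite (lmulEw (msupp_term _ _) (msupp_term _ _)) !big_seq_fset1.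
by rewrite !coef_term !eqxx.
Qed.

Lemma lmulUp c a p :
  lmul (term c a) p = \sum_(b <- msupp p) term (c * p@_b) (a + b).
Proof.
rewrite (lmulEw (msupp_term _ _) (fsubset_refl _)) big_seq_fset1.
by apply: eq_bigr => b _; rewrite coef_term eqxx.
Qed.

Lemma lmul1p : left_id (mono K 0) (@lmul K n).
Proof.
move=> p; rewrite [RHS]laurentE lmulUp.
by apply: eq_bigr => b _; rewrite mul1r add0r.
Qed.

Lemma lmul_suml (I : Type) (s : seq I) (F : I -> laurent K n) q :
  lmul (\sum_(i <- s) F i) q = \sum_(i <- s) lmul (F i) q.
Proof.
by apply: (big_morph (fun p => lmul p q)) => [x y|]; [exact: lmulDl|exact: lmul0p].
Qed.

Lemma lmul_sumr (I : Type) (s : seq I) (F : I -> laurent K n) q :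
  lmul q (\sum_(i <- s) F i) = \sum_(i <- s) lmul q (F i).
Proof.
by apply: (big_morph (lmul q)) => [x y|]; [exact: lmulDr|exact: lmulp0].
Qed.

Lemma lmulA : associative (@lmul K n).
Proof.
move=> p q r; rewrite [p]laurentE [q]laurentE [r]laurentE.
rewrite !lmul_suml; apply: eq_bigr => a _.
rewrite !(lmul_sumr _ _ (term p@_a a)) lmul_suml.
apply: eq_bigr => b _; rewrite !lmul_sumr; apply: eq_bigr => c _.
by rewrite !lmulUU mulrA addrA.
Qed.

Lemma mono0_neq0 : mono K (0 : 'rV[int]_n) != 0 :> laurent K n.
Proof.
apply/eqP => /laurentP/(_ 0)/eqP.
by rewrite coef_term eqxx mcoeff0 oner_eq0.
Qed.

HB.instance Definition _ := GRing.Zmodule_isComNzRing.Build (laurent K n)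
  lmulA lmulC lmul1p lmulDl mono0_neq0.

Lemma lscaleAl c p q : c *: (p * q) = (c *: p) * q.
Proof.
suff mul_c r : term c 0 * r = c *: r by rewrite -!mul_c mulrA.
rewrite [LHS]lmulUp [in RHS](laurentE r) scaler_sumr.
by apply: eq_bigr => b _; rewrite termZ add0r.
Qed.

HB.instance Definition _ :=
  GRing.Lmodule_isLalgebra.Build K (laurent K n) lscaleAl.
HB.instance Definition _ := GRing.Lalgebra_isComAlgebra.Build K (laurent K n).

End LaurentRing.

Definition ldeg n (m : 'rV[int]_n) : nat :=
  (\sum_(k < n) `|m ord0 k|)%N.

(* As with size for {poly K}, lsize p = delta(p) + 1, so that the zero
   polynomial, of degree -oo, has size 0. *)
Definition lsize (K : fieldType) (n : nat) (p : laurent K n) : nat :=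
  (\max_(m <- msupp p) (ldeg m).+1)%N.

Definition deg_le (K : fieldType) (n : nat) (d : nat) (p : laurent K n) : bool :=
  (lsize p <= d.+1)%N.

(* Variables are indexed by integers as in x_(-n), ..., x_n: xexp n i is the
   exponent of x_i, with x_0 = 1 and x_(-i) = x_i^-1.  The coordinate k : 'I_n
   is that of x_(k+1). *)
Definition xexp n (i : int) : 'rV[int]_n :=
  \row_(k < n) (if `|i|%N == k.+1 then sgz i else 0).

Definition xvar (K : fieldType) (n : nat) (i : int) : laurent K n :=
  mono K (xexp n i).

(* i belongs to [-n, n] \ {0} *)
Definition nzidx (n : nat) (i : int) : bool := (i != 0) && (`|i| <= n)%N.

Section Monomials.
Variables (n : nat) (B : {fset 'rV[int]_n}).

Definition extension (m : 'rV[int]_n) : Prop :=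
  m \in B \/ exists i m', [/\ nzidx n i, m' \in B & m = xexp n i + m'].

Definition border (m : 'rV[int]_n) : Prop := extension m /\ m \notin B.

Definition connected_to_1 : Prop :=
  0 \in B /\
  forall m, m \in B -> m != 0 ->
    exists i m', [/\ nzidx n i, m' \in B, m = xexp n i + m'
                   & (ldeg m' < ldeg m)%N].

End Monomials.

Definition monospan (K : fieldType) (n : nat) (A : 'rV[int]_n -> Prop) :
    laurent K n -> Prop :=
  generated (fun p => exists2 m, A m & p = mono K m).

(* The symbols Y_i[m] that form the basis of S_1 *)
Definition syz_index (n : nat) (B : {fset 'rV[int]_n}) : choiceType :=
  {k : int * 'rV[int]_n
     | [&& nzidx n k.1, k.2 \in B & xexp n k.1 + k.2 \notin B]}.

Definition syz_module (K : fieldType) (n : nat) (B : {fset 'rV[int]_n}) :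
  lmodType (laurent K n) := {malg (laurent K n)[syz_index B]}.

(* Y_i[m], which is 0 by convention when m and x_i m both belong to B *)
Definition Ysym (K : fieldType) (n : nat) (B : {fset 'rV[int]_n}) (i : int)
    (m : 'rV[int]_n) : syz_module K B :=
  if insub (i, m) is Some k then << (k : syz_index B) >> else 0.

(* Y_i[p] for p in <B>; the scalars of K act on S_1 through K -> S. *)
HB.lock Definition Yext (K : fieldType) (n : nat) (B : {fset 'rV[int]_n})
    (i : int) (p : laurent K n) : syz_module K B :=
  \sum_(m <- msupp p) (p@_m)%:A *: Ysym K B i m.
Arguments Yext {K n} B i p.

Section BorderBasis.
Variables (K : fieldType) (n : nat) (B : {fset 'rV[int]_n}).

Local Notation S := (laurent K n).
Local Notation spanB := (@monospan K n (fun m => m \in B)).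
Local Notation spanBx := (@monospan K n (extension B)).

Variable pi : S -> S.

(* pi is total, but only its restriction to <B^x> is constrained, and only
   that restriction is used below. *)
Record border_projection : Prop := BorderProjection {
  bp_range : forall p, spanBx p -> spanB (pi p);
  bp_linear : forall (c : K) p q,
    spanBx p -> spanBx q -> pi (c *: p + q) = c *: pi p + pi q;
  bp_id : forall p, spanB p -> pi p = p;
  bp_degree : forall p, spanBx p -> (lsize (pi p) <= lsize p)%N
}.

Definition Ffam (f : S) : Prop :=
  exists2 m, border B m & f = mono K m - pi (mono K m).

Definition Xop (i : int) (b : S) : S := pi (xvar K n i * b).

(* X_1^(a_1) o ... o X_n^(a_n) applied to 1 *)
Definition sigma_mono (a : 'rV[int]_n) : S :=
  foldr (fun (k : 'I_n) (b : S) =>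
           iter `|a ord0 k|%N
             (Xop (if 0 <= a ord0 k then k.+1%:Z else - k.+1%:Z)) b)
        1 (enum 'I_n).

Definition sigma (p : S) : S := linext sigma_mono p.

(* F_[<= d] *)
Definition Fmult (d : nat) (p : S) : Prop :=
  exists m f, [/\ Ffam f, p = mono K m * f & deg_le d p].

Record operator_condition (d : nat) : Prop := OperatorCondition {
  oc_inverse : forall i : int, 1 <= i <= n%:Z ->
    forall b, spanB b -> deg_le (d - 2) b -> Xop i (Xop (- i) b) = b;
  oc_commute : forall i j : int, 1 <= i -> i < j -> j <= n%:Z ->
    forall b, spanB b -> deg_le (d - 2) b ->
      Xop i (Xop j b) = Xop j (Xop i b)
}.

Record projection_condition (d : nat) : Prop := ProjectionCondition {
  pc_range : forall p, deg_le d p -> spanB (sigma p) /\ deg_le d (sigma p);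
  pc_id : forall p, spanB p -> deg_le d p -> sigma p = p;
  pc_kernel : forall p, (deg_le d p /\ sigma p = 0) <-> generated (Fmult d) p
}.

(* In the second clause i or j may be 0, where x_0 = 1. *)
Record reduction_condition (d : nat) : Prop := ReductionCondition {
  rc_next_door : forall (i : int) f, nzidx n i -> Ffam f -> deg_le (d - 1) f ->
    spanBx (xvar K n i * f) -> pi (xvar K n i * f) = 0;
  rc_across : forall (i j : int) f f', - n%:Z <= i -> i < j -> j <= n%:Z ->
    Ffam f -> deg_le (d - 1) f -> Ffam f' -> deg_le (d - 1) f' ->
    spanBx (xvar K n i * f - xvar K n j * f') ->
    pi (xvar K n i * f - xvar K n j * f') = 0
}.

Record border_basis_in_degree (d : nat) : Prop := BorderBasisInDegree {
  bb_operator : operator_condition d;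
  bb_projection : projection_condition d;
  bb_reduction : reduction_condition d
}.

Definition border_basis_in_any_degree : Prop :=
  forall d : nat, (2 <= d)%N -> border_basis_in_degree d.

Definition psi (i : int) (b : S) : S := xvar K n i * b - pi (xvar K n i * b).

Definition partial1 : {linear syz_module K B -> S^o} :=
  linext (fun k : syz_index B => psi (val k).1 (mono K (val k).2) : S^o).

Definition rho (i : int) (m : 'rV[int]_n) : syz_module K B :=
  xvar K n i *: Ysym K B (- i) m + Yext B i (Xop (- i) (mono K m)).

Definition phi (i j : int) (m : 'rV[int]_n) : syz_module K B :=
  xvar K n i *: Ysym K B j m - xvar K n j *: Ysym K B i m
  + Yext B i (Xop j (mono K m)) - Yext B j (Xop i (mono K m)).

Definition basic_syzygy (g : syz_module K B) : Prop :=
  (exists i m, [/\ nzidx n i, m \in B & g = rho i m]) \/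
  (exists i j m, [/\ nzidx n i, nzidx n j, i != j, m \in B & g = phi i j m]).

End BorderBasis.

(* Main.v *)
(* Let N be the submodule generated by the rho_i(m) and phi_ij(m).  Since the
   kernel of sigma is the ideal (F) and sigma is the identity on <B>, the X_i
   commute and X_i, X_(-i) are mutually inverse on <B>; this puts N in the
   kernel.  Conversely, T_i(q, b) = (x_i q + Y_i[b], X_i(b)) on (S_1/N) x <B>
   satisfies T_i T_j = T_j T_i and T_i T_(-i) = 1, so that it extends to an
   action of Z^n.  Let h : S -> S_1/N be the K-linear map sending x^a to the
   first component of T^a(0, 1); then h(1) = 0 and
   h(x_i p) = x_i h(p) + Y_i[sigma(p)].  Connectedness of B gives h = 0 on <B>,
   because Y_i[m] = 0 when m and x_i m are both in B.  Hence
   h(psi_i(m)) = Y_i[m], and h is S-linear on (F), so h o partial1 is the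
   projection of S_1 onto S_1/N and ker partial1 is contained in N. *)

From HB Require Import structures.
Require Import Defs.
From mathcomp Require Import all_boot all_order all_algebra.
From mathcomp Require Import finmap ring.
From mathcomp.multinomials Require Import monalg.

Set Implicit Arguments.
Unset Strict Implicit.
Unset Printing Implicit Defensive.

Import Order.TTheory GRing.Theory Num.Theory.

Local Open Scope ring_scope.

Section Generated.
Variables (R : nzRingType) (V : lmodType R) (G : V -> Prop).

Lemma generated0 : generated G 0.
Proof. by exists [::]; split=> //; rewrite big_nil. Qed.

Lemma generated_cons (c : R) (u v : V) :
  G u -> generated G v -> generated G (c *: u + v).
Proof.
move=> Gu [r [Gr ->]]; exists ((c, u) :: r); split; last by rewrite big_cons.
by move=> t; rewrite inE => /orP[/eqP ->|/Gr].
Qed.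

Lemma generated_ind (P : V -> Prop) :
  P 0 ->
  (forall c u v, G u -> generated G v -> P v -> P (c *: u + v)) ->
  forall v, generated G v -> P v.
Proof.
move=> P0 PD v [r [Gr ->]]; elim: r Gr => [|t r IHr] Gr; first by rewrite big_nil.
rewrite big_cons; have Gr' s : s \in r -> G s.2.
  by move=> sr; apply: Gr; rewrite inE sr orbT.
apply: PD; [by apply: Gr; rewrite inE eqxx|by exists r|exact: IHr].
Qed.

Lemma generated_mem v : G v -> generated G v.
Proof. by move=> Gv; rewrite -[v]addr0 -[v]scale1r; apply: generated_cons generated0. Qed.

Lemma generatedD u v : generated G u -> generated G v -> generated G (u + v).
Proof.
move=> Gu Gv; elim/generated_ind: u / Gu => [|c u w Gu _ IH]; first by rewrite add0r.
by rewrite -addrA; apply: generated_cons.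
Qed.

Lemma generatedZ c v : generated G v -> generated G (c *: v).
Proof.
elim/generated_ind: v / => [|a u v Gu _ IH]; first by rewrite scaler0; exact: generated0.
by rewrite scalerDr scalerA; apply: generated_cons.
Qed.

Lemma generatedN v : generated G v -> generated G (- v).
Proof. by rewrite -scaleN1r; apply: generatedZ. Qed.

End Generated.

Lemma malgU_scale (R : nzRingType) (I : choiceType) (c : R) (k : I) :
  << c *g k >> = c *: << k >> :> {malg R[I]}.
Proof. by apply/malgP => l; rewrite mcoeffZ !mcoeffU mulr_natr. Qed.

(* In an abstract module, because unification diverges when these rearrangements
   are rewritten directly in syz_module. *)
Section Rearrangement.
Variables (R : comNzRingType) (V : lmodType R).
Implicit Types (x y a : R) (s t u v : V).

Lemma scalerC x y v : x *: (y *: v) = y *: (x *: v).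
Proof. by rewrite !scalerA mulrC. Qed.

Lemma rho_linear a x u u' v v' :
  x *: (a *: u + u') + (a *: v + v') = a *: (x *: u + v) + (x *: u' + v').
Proof. by rewrite !scalerDr (scalerC x) addrACA. Qed.

Lemma phi_linear a x y s s' t t' u u' v v' :
  x *: (a *: s + s') - y *: (a *: t + t') + (a *: u + u') - (a *: v + v') =
  a *: (x *: s - y *: t + u - v) + (x *: s' - y *: t' + u' - v').
Proof.
rewrite !scalerDr !scalerN (scalerC x) (scalerC y) !opprD.
rewrite (addrACA (a *: (x *: s)) (x *: s')).
rewrite (addrACA (_ - _) (x *: s' - _)).
by rewrite (addrACA (_ + a *: u) (_ + u')).
Qed.

Lemma rho_cancel x y u v w : x * y = 1 ->
  x *: (y *: w + u) + v - w = x *: u + v.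
Proof. by move=> xy; rewrite scalerDr scalerA xy scale1r addrC -addrA addKr. Qed.

Lemma scalerBD x u v w : x *: u + w - (x *: v + w) = x *: (u - v).
Proof. by rewrite opprD addrACA subrr addr0 scalerBr. Qed.

Lemma scalerDB a u u' v v' :
  a *: u + u' - (a *: v + v') = a *: (u - v) + (u' - v').
Proof. by rewrite opprD addrACA scalerBr. Qed.

Lemma subr_insert x u v w : v - x *: w = v - x *: u + x *: (u - w).
Proof. by rewrite scalerBr subrKA. Qed.

Lemma subr_split x u v v' w w' :
  v + v' - (x *: w + w') = v - x *: u + x *: (u - w) + (v' - w').
Proof. by rewrite -subr_insert opprD addrACA. Qed.

Lemma rho_defect_linear a x u u' v v' w w' :
  a *: u + u' - (x *: (a *: v + v') + (a *: w + w')) =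
  a *: (u - (x *: v + w)) + (u' - (x *: v' + w')).
Proof. by rewrite rho_linear scalerDB. Qed.

Lemma subrDK u v w : u - (v + w) + v = u - w.
Proof. by rewrite opprD addrA addrAC subrK. Qed.

Lemma phi_commutator x y s t u v w :
  x *: (y *: w + s) + u - (y *: (x *: w + t) + v) =
  x *: s - y *: t + u - v.
Proof.
rewrite !scalerDr (scalerC y); move: (x *: (y *: w)) => A.
rewrite -[A + _ + u]addrA -[A + _ + v]addrA [A + _]addrC addrKA opprD addrA.
by rewrite (addrAC _ u).
Qed.

Lemma linear_phi (f : {linear V -> R^o}) x y s t u v :
  f (x *: s - y *: t + u - v) = x * f s - y * f t + f u - f v.
Proof. by rewrite raddfB raddfD raddfB /= !linearZ. Qed.

Lemma koszul_identity (x y m p q r : R) :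
  x * (y * m - p) - y * (x * m - q) + (x * p - r) - (y * q - r) = 0.
Proof. by ring. Qed.

End Rearrangement.

Section LaurentVariables.
Variable n : nat.

Lemma nzidxN i : nzidx n (- i) = nzidx n i.
Proof. by rewrite /nzidx oppr_eq0 abszN. Qed.

Lemma nzidxS (k : 'I_n) : nzidx n k.+1%:Z.
Proof. by rewrite /nzidx /=. Qed.

Lemma nzidx_sign (b : bool) (k : 'I_n) : nzidx n (if b then k.+1%:Z else - k.+1%:Z).
Proof. by case: b; rewrite ?nzidxN nzidxS. Qed.

Lemma nzidxP i : nzidx n i ->
  exists k : 'I_n, i = k.+1%:Z \/ i = - k.+1%:Z.
Proof.
case/andP; case: i => [[|k]|k] // _ kn; exists (Ordinal kn); first by left.
by right; rewrite NegzE.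
Qed.

Lemma xexpNr i : xexp n i + xexp n (- i) = 0.
Proof. by apply/rowP => k; rewrite !mxE abszN sgzN; case: ifP; rewrite ?subrr ?addr0. Qed.

Lemma xexp_ind (P : 'rV[int]_n -> Prop) :
  P 0 -> (forall a b, P a -> P b -> P (a + b)) ->
  (forall i, nzidx n i -> P (xexp n i)) -> forall a, P a.
Proof.
move=> P0 PD Px a; pose s (k : 'I_n) := if 0 <= a ord0 k then k.+1%:Z else - k.+1%:Z.
have absz_s k : `|s k|%N = k.+1 by rewrite /s; case: ifP; rewrite ?abszN.
have -> : a = \sum_k xexp n (s k) *+ `|a ord0 k|.
  apply/rowP => l; rewrite summxE (bigD1 l) //= big1 ?addr0 => [|k kl].
    rewrite mulmxnE mxE absz_s eqxx /s.
    by case: (a _ l) => m; rewrite ?NegzE ?abszN pmulrn mulrzz ?sgzN gtr0_sgz //;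
      rewrite ?mulN1r ?mul1r.
  by rewrite mulmxnE mxE absz_s eqSS ifN ?mul0rn // eq_sym.
apply: big_ind => // k _; elim: `|_|%N => [|m IHm]; first by rewrite mulr0n.
by rewrite mulrS; apply: PD => //; apply: Px; apply: nzidx_sign.
Qed.

End LaurentVariables.

Section IntegerPowers.
Variables (n : nat) (Z : Type) (T : int -> Z -> Z).

Definition zact (s : seq 'I_n) (a : 'rV[int]_n) (z : Z) : Z :=
  foldr (fun (k : 'I_n) (y : Z) =>
           iter `|a ord0 k|%N
             (T (if 0 <= a ord0 k then k.+1%:Z else - k.+1%:Z)) y) z s.

(* A partial equivalence: the operators commute and cancel only on the domain
   of R, and only up to R. *)
Variable R : Z -> Z -> Prop.
Hypothesis R_sym : forall y z, R y z -> R z y.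
Hypothesis R_trans : forall x y z, R x y -> R y z -> R x z.
Hypothesis T_proper : forall i y z, nzidx n i -> R y z -> R (T i y) (T i z).
Hypothesis T_comm : forall i j z, nzidx n i -> nzidx n j -> R z z ->
  R (T i (T j z)) (T j (T i z)).
Hypothesis T_inv : forall i z, nzidx n i -> R z z -> R (T i (T (- i) z)) z.

Lemma iter_proper i m y z : nzidx n i -> R y z -> R (iter m (T i) y) (iter m (T i) z).
Proof. by move=> ni Ryz; elim: m => //= m; apply: T_proper. Qed.

Lemma iter_comm i j m z : nzidx n i -> nzidx n j -> R z z ->
  R (iter m (T j) (T i z)) (T i (iter m (T j) z)).
Proof.
move=> ni nj Rz; elim: m => [|m IHm] /=; first exact: T_proper.
by apply: R_trans (T_proper nj IHm) _; apply: T_comm => //; apply: iter_proper.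
Qed.

Definition zpow (k : 'I_n) (c : int) (y : Z) : Z :=
  iter `|c|%N (T (if 0 <= c then k.+1%:Z else - k.+1%:Z)) y.

Lemma zpow_proper k c y z : R y z -> R (zpow k c y) (zpow k c z).
Proof. by apply: iter_proper; apply: nzidx_sign. Qed.

Lemma zpow_nat k (m : nat) z : zpow k m%:Z z = iter m (T k.+1%:Z) z.
Proof. by []. Qed.

Lemma zpow_natN k (m : nat) z : zpow k (- m%:Z) z = iter m (T (- k.+1%:Z)) z.
Proof. by case: m => //= m; rewrite /zpow abszN oppr_ge0. Qed.

Lemma zpow_succ k c z : R z z -> R (zpow k (1 + c) z) (T k.+1%:Z (zpow k c z)).
Proof.
move=> Rz; have nk := nzidxS k; case: c => m.
  rewrite -PoszD !zpow_nat; apply: T_proper => //; exact: iter_proper.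
rewrite NegzE -[in 1 + _]addn1 PoszD opprD addrCA subrr addr0 !zpow_natN /=.
by apply: R_sym; apply: T_inv => //; apply: iter_proper; rewrite ?nzidxN.
Qed.

Lemma zpow_pred k c z : R z z -> R (zpow k (-1 + c) z) (T (- k.+1%:Z) (zpow k c z)).
Proof.
move=> Rz; have nk : nzidx n (- k.+1%:Z) by rewrite nzidxN nzidxS.
have Rzz c' : R (zpow k c' z) (zpow k c' z) by apply: zpow_proper.
have {2}-> : c = 1 + (-1 + c) by rewrite addrA subrr add0r.
apply: R_sym; apply: R_trans (T_proper nk (zpow_succ k _ Rz)) _.
by rewrite -[X in T _ (T X _)]opprK; apply: T_inv.
Qed.

Lemma zactE k s a z : zact (k :: s) a z = zpow k (a ord0 k) (zact s a z).
Proof. by []. Qed.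

Lemma zact_proper s a y z : R y z -> R (zact s a y) (zact s a z).
Proof. by move=> Ryz; elim: s => // k s; rewrite !zactE; apply: zpow_proper. Qed.

Lemma eq_zact s (a b : 'rV[int]_n) z :
  {in s, forall k, a ord0 k = b ord0 k} ->
  zact s a z = zact s b z.
Proof.
elim: s => // k s IHs eqab; rewrite !zactE eqab ?inE ?eqxx // IHs // => l ls.
by rewrite eqab // inE ls orbT.
Qed.

Lemma zact0 s z : zact s 0 z = z.
Proof. by elim: s => // k s IHs; rewrite zactE IHs /zpow mxE. Qed.

Lemma zactD i a z : nzidx n i -> R z z ->
  R (zact (enum 'I_n) (xexp n i + a) z) (T i (zact (enum 'I_n) a z)).
Proof.
move=> ni Rz; have [k ik] := nzidxP ni.
have xexpE l : xexp n i ord0 l = if l == k then sgz i else 0.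
  rewrite mxE; have -> : `|i|%N = k.+1 by case: ik => ->; rewrite ?abszN.
  by rewrite eqSS eq_sym.
have : k \in enum 'I_n by rewrite mem_enum.
elim: (enum 'I_n) (enum_uniq 'I_n) => // l s IHs; rewrite cons_uniq => /andP[ls us].
have Rs b : R (zact s b z) (zact s b z) by apply: zact_proper.
rewrite !zactE inE mxE xexpE eq_sym; have [kl _|kl /= ks] := eqVneq k l.
  rewrite (@eq_zact s (xexp n i + a) a); last first.
    by move=> j js; rewrite mxE xexpE ifN ?add0r // kl; apply: contraNneq ls => <-.
  by rewrite -kl; case: ik => ->; [apply: zpow_succ|rewrite sgzN; apply: zpow_pred].
rewrite add0r; apply: R_trans (zpow_proper _ _ (IHs us ks)) _.
by apply: iter_comm => //; apply: nzidx_sign.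
Qed.

End IntegerPowers.

(* The K-linear extension of h, where K acts on V through K -> S. *)
HB.lock Definition kext (K : fieldType) (n : nat) (V : lmodType (laurent K n))
    (h : 'rV[int]_n -> V) (p : laurent K n) : V :=
  \sum_(a <- msupp p) (p@_a)%:A *: h a.

Section ScalarExtension.
Variables (K : fieldType) (n : nat).
Local Notation S := (laurent K n).
Implicit Types (p q : S) (a b : 'rV[int]_n).

Lemma monoM a b : mono K a * mono K b = mono K (a + b).
Proof. by rewrite [LHS]lmulUU mulr1. Qed.

Lemma laurent_ind (P : S -> Prop) :
  P 0 -> (forall c a q, P q -> P (c *: mono K a + q)) -> forall p, P p.
Proof.
move=> P0 PD p; rewrite [p]laurentE; elim: (enum_fset _) => [|a s IHs].
  by rewrite big_nil.
by rewrite big_cons -[p@_a]mulr1 -termZ; apply: PD.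
Qed.

Lemma malg_scaleE (c : K) p :
  c *: p = c *: (p : {malg K['rV[int]_n]}) :> {malg K['rV[int]_n]}.
Proof. by apply/malgP => a; rewrite mcoeffZ; apply: coef_scale. Qed.

Lemma linext_laurent_linear (V : lmodType K) (h : 'rV[int]_n -> V) c p q :
  linext h (c *: p + q) = c *: linext h p + linext h q.
Proof. by rewrite malg_scaleE; apply: linext_is_linear. Qed.

Variables (V : lmodType S) (h : 'rV[int]_n -> V).

Lemma kextEw (d : {fset 'rV[int]_n}) p :
  (msupp p `<=` d)%fset -> kext h p = \sum_(a <- d) (p@_a)%:A *: h a.
Proof.
move=> le; rewrite kext.unlock (big_fset_incl _ le) //= => a _ /mcoeff_outdom ->.
by rewrite !scale0r.
Qed.

Lemma kext_linear c p q : kext h (c *: p + q) = c%:A *: kext h p + kext h q.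
Proof.
pose d := (msupp p `|` msupp q `|` msupp (c *: p + q))%fset.
have dp : (msupp p `<=` d)%fset by rewrite /d -fsetUA fsubsetUl.
have dq : (msupp q `<=` d)%fset by rewrite /d fsetUAC fsubsetUr.
rewrite (kextEw (fsubsetUr _ _ : _ `<=` d)%fset) (kextEw dp) (kextEw dq).
rewrite scaler_sumr -big_split; apply: eq_bigr => a _ /=.
by rewrite mcoeffD coef_scale scalerDl scalerDl scalerA -scalerAl mul1r scalerA.
Qed.

Lemma kext0 : kext h 0 = 0.
Proof. by rewrite kext.unlock msupp0 big_seq_fset0. Qed.

Lemma kextD p q : kext h (p + q) = kext h p + kext h q.
Proof. by rewrite -[p]scale1r kext_linear !scale1r. Qed.

Lemma kext_mono a : kext h (mono K a) = h a.
Proof.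
by rewrite (kextEw (msupp_term _ _)) big_seq_fset1 coef_term eqxx !scale1r.
Qed.

End ScalarExtension.

Section BorderBasisSyzygies.
Variables (K : fieldType) (n : nat) (B : {fset 'rV[int]_n}).
Local Notation S := (laurent K n).
Local Notation spanB := (@monospan K n (fun m => m \in B)).
Local Notation spanBx := (@monospan K n (extension B)).
Implicit Types (p q b f : S) (i j : int) (m a : 'rV[int]_n).
Variable pi : S -> S.
Hypothesis B_connected : connected_to_1 B.
Hypothesis pi_projection : border_projection B pi.
Hypothesis F_border_basis : border_basis_in_any_degree B pi.

Lemma spanB_mono m : m \in B -> spanB (mono K m).
Proof. by move=> Bm; apply: generated_mem; exists m. Qed.

Lemma spanBx_xvarM i p : nzidx n i -> spanB p -> spanBx (xvar K n i * p).
Proof.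
move=> ni; elim/generated_ind: p / => [|c _ v [m Bm ->] _ IH].
  by rewrite mulr0; apply: generated0.
rewrite mulrDr -scalerAr monoM; apply: generated_cons IH.
by exists (xexp n i + m) => //; right; exists i, m.
Qed.

Lemma spanB_Xop i p : nzidx n i -> spanB p -> spanB (Xop pi i p).
Proof. by move=> ni Bp; apply: (bp_range pi_projection); apply: spanBx_xvarM. Qed.

Lemma Xop_linear i c p q : nzidx n i -> spanB p -> spanB q ->
  Xop pi i (c *: p + q) = c *: Xop pi i p + Xop pi i q.
Proof.
move=> ni Bp Bq; rewrite /Xop mulrDr -scalerAr.
by apply: (bp_linear pi_projection); apply: spanBx_xvarM.
Qed.

Lemma Xop0 i : Xop pi i 0 = 0.
Proof. by rewrite /Xop mulr0 (bp_id pi_projection) //; apply: generated0. Qed.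

Lemma psi_linear i c p q : nzidx n i -> spanB p -> spanB q ->
  psi pi i (c *: p + q) = c *: psi pi i p + psi pi i q.
Proof.
move=> ni Bp Bq; rewrite /psi -!/(Xop _ _ _) Xop_linear // mulrDr -scalerAr scalerBr.
by rewrite opprD addrACA.
Qed.

Lemma psi0 i : psi pi i 0 = 0.
Proof. by rewrite /psi -/(Xop _ _ _) Xop0 mulr0 subr0. Qed.

Lemma psi_inside i m : m \in B -> xexp n i + m \in B -> psi pi i (mono K m) = 0.
Proof.
move=> Bm Bim; rewrite /psi monoM (bp_id pi_projection) ?subrr //.
exact: spanB_mono.
Qed.

Lemma psi_outside i m : nzidx n i -> m \in B -> xexp n i + m \notin B ->
  Ffam B pi (psi pi i (mono K m)).
Proof.
move=> ni Bm Bim; exists (xexp n i + m); last by rewrite /psi monoM.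
by split=> //; right; exists i, m.
Qed.

Lemma projection_condition_large p : exists2 d, deg_le d p & projection_condition B pi d.
Proof.
exists (lsize p).+2; first by rewrite /deg_le -addn3 leq_addr.
exact: bb_projection (F_border_basis _).
Qed.

Lemma sigma_linear c p q : sigma pi (c *: p + q) = c *: sigma pi p + sigma pi q.
Proof. exact: linext_laurent_linear. Qed.

Lemma sigma0 : sigma pi 0 = 0.
Proof. by have := sigma_linear (-1) 0 0; rewrite scaler0 addr0 scaleN1r addNr. Qed.

Lemma sigmaD p q : sigma pi (p + q) = sigma pi p + sigma pi q.
Proof. by rewrite -[p in LHS]scale1r sigma_linear scale1r. Qed.

Lemma sigma_monoE a : sigma pi (mono K a) = sigma_mono pi a.
Proof. by rewrite /sigma /mono term.unlock linextU scale1r. Qed.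

Lemma sigma_id p : spanB p -> sigma pi p = p.
Proof. by move=> Bp; have [d dp P] := projection_condition_large p; apply: (pc_id P). Qed.

Lemma spanB_sigma p : spanB (sigma pi p).
Proof. by have [d dp P] := projection_condition_large p; have [] := pc_range P dp. Qed.

Lemma sigma_Ffam a f : Ffam B pi f -> sigma pi (mono K a * f) = 0.
Proof.
move=> Ff; have [d dp P] := projection_condition_large (mono K a * f).
apply: proj2 ((pc_kernel P _).2 _); apply: generated_mem.
by exists a, f.
Qed.

Lemma sigma_psi i a b : nzidx n i -> spanB b -> sigma pi (mono K a * psi pi i b) = 0.
Proof.
move=> ni; elim/generated_ind: b / => [|c _ v [m Bm ->] Bv IH].
  by rewrite psi0 mulr0 sigma0.
rewrite psi_linear //; last exact: spanB_mono.
rewrite mulrDr -scalerAr sigma_linear IH addr0.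
have [Bim|Bim] := boolP (xexp n i + m \in B).
  by rewrite psi_inside // mulr0 sigma0 scaler0.
by rewrite sigma_Ffam ?scaler0 //; apply: psi_outside.
Qed.

Lemma sigma_mulXop i a b : nzidx n i -> spanB b ->
  sigma pi (mono K a * Xop pi i b) = sigma pi (mono K a * (xvar K n i * b)).
Proof.
move=> ni Bb; have -> : xvar K n i * b = psi pi i b + Xop pi i b by rewrite subrK.
by rewrite mulrDr sigmaD sigma_psi // add0r.
Qed.

Lemma Xop_Xop i j b : nzidx n i -> nzidx n j -> spanB b ->
  Xop pi i (Xop pi j b) = sigma pi (xvar K n i * (xvar K n j * b)).
Proof.
move=> ni nj Bb; have BXb := spanB_Xop nj Bb.
rewrite -sigma_mulXop // -[LHS]sigma_id; last exact: spanB_Xop.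
by rewrite -[Xop pi i _]mul1r -[1]/(mono K 0) sigma_mulXop // mul1r.
Qed.

Lemma Xop_comm i j b : nzidx n i -> nzidx n j -> spanB b ->
  Xop pi i (Xop pi j b) = Xop pi j (Xop pi i b).
Proof. by move=> ni nj Bb; rewrite !Xop_Xop // mulrCA. Qed.

Lemma Xop_inv i b : nzidx n i -> spanB b -> Xop pi i (Xop pi (- i) b) = b.
Proof.
move=> ni Bb; rewrite Xop_Xop ?nzidxN // mulrA monoM.
by rewrite xexpNr mul1r sigma_id.
Qed.

Local Notation Q := (syz_module K B).
Local Notation N := (generated (basic_syzygy pi (B := B))).
Local Notation Y := (Ysym K B).

Lemma YextE i p : Yext B i p = kext (Y i) p.
Proof. by rewrite Yext.unlock kext.unlock. Qed.

Lemma Ysym_inside i m : xexp n i + m \in B -> Y i m = 0.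
Proof. by move=> Bim; rewrite /Ysym insubN //= Bim !andbF. Qed.

Lemma Ysym_val (k : syz_index B) : Y (val k).1 (val k).2 = << k >>.
Proof. by rewrite /Ysym -surjective_pairing valK. Qed.

Lemma phi_span i j b : nzidx n i -> nzidx n j -> spanB b ->
  N (xvar K n i *: Yext B j b - xvar K n j *: Yext B i b
     + Yext B i (Xop pi j b) - Yext B j (Xop pi i b)).
Proof.
move=> ni nj; have [<- _|ij] := eqVneq i j.
  by rewrite subrr add0r subrr; apply: generated0.
elim/generated_ind: b / => [|c _ v [m Bm ->] Bv IH].
  by rewrite !Xop0 !YextE !kext0 !scaler0 subrr addr0 subrr; apply: generated0.
have Bmm := spanB_mono Bm.
have Nm : N (phi B pi i j m) by apply: generated_mem; right; exists i, j, m.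
rewrite !Xop_linear // !YextE !kext_linear phi_linear; apply: generatedD; last first.
  by rewrite -!YextE.
by apply: generatedZ; rewrite !kext_mono -!YextE.
Qed.

Lemma rho_span i b : nzidx n i -> spanB b ->
  N (xvar K n i *: Yext B (- i) b + Yext B i (Xop pi (- i) b)).
Proof.
move=> ni; elim/generated_ind: b / => [|c _ v [m Bm ->] Bv IH].
  by rewrite !Xop0 !YextE !kext0 scaler0 addr0; apply: generated0.
have Bmm := spanB_mono Bm.
have Nm : N (rho B pi i m) by apply: generated_mem; left; exists i, m.
rewrite Xop_linear ?nzidxN // !YextE !kext_linear rho_linear.
apply: generatedD; last first.
  by rewrite -!YextE.
by apply: generatedZ; rewrite !kext_mono -!YextE.
Qed.

Lemma partial1_Ysym i m : nzidx n i -> m \in B ->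
  partial1 B pi (Y i m) = psi pi i (mono K m).
Proof.
move=> ni Bm; rewrite /Ysym; case: insubP => [k _ kE|].
  by rewrite [LHS]linextU scale1r kE.
rewrite /= ni Bm negbK => Bim; rewrite psi_inside //; exact: raddf0.
Qed.

Lemma partial1_Yext i b : nzidx n i -> spanB b ->
  partial1 B pi (Yext B i b) = psi pi i b.
Proof.
move=> ni; rewrite YextE; elim/generated_ind: b / => [|c _ v [m Bm ->] Bv IH].
  by rewrite kext0 psi0; exact: raddf0.
rewrite psi_linear ?kext_linear //; last exact: spanB_mono.
rewrite [LHS]linearP kext_mono partial1_Ysym //; congr (_ + _); last exact: IH.
exact: (mulr_algl c (psi pi i (mono K m))).
Qed.

Lemma partial1_basic g : basic_syzygy pi g -> partial1 B pi g = 0.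
Proof.
case=> [[i [m [ni Bm ->]]]|[i [j [m [ni nj _ Bm ->]]]]].
  have nNi : nzidx n (- i) by rewrite nzidxN.
  have Bmm := spanB_mono Bm.
  rewrite [LHS]linearP partial1_Ysym // partial1_Yext //; last exact: spanB_Xop.
  rewrite /psi -!/(Xop _ _ _) Xop_inv // [_ *: _]mulrBr addrA subrK.
  by rewrite mulrA monoM xexpNr mul1r subrr.
have Bmm := spanB_mono Bm.
have BXi := spanB_Xop ni Bmm; have BXj := spanB_Xop nj Bmm.
rewrite [LHS]linear_phi !partial1_Ysym // !partial1_Yext //.
rewrite /psi -!/(Xop _ _ _) (Xop_comm nj) //; exact: koszul_identity.
Qed.

(* Modulo the basic syzygies, rho_i(m) says that step i cancels step (- i), and
   phi_ij(m) that step i and step j commute. *)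
Definition step i (z : Q * S) : Q * S :=
  (xvar K n i *: z.1 + Yext B i z.2, Xop pi i z.2).

Definition step_eq (y z : Q * S) : Prop :=
  [/\ y.2 = z.2, spanB z.2 & N (y.1 - z.1)].

Lemma step_eq_sym y z : step_eq y z -> step_eq z y.
Proof.
case=> yz Bz Nyz; split=> //; first by rewrite yz.
by rewrite -opprB; apply: generatedN.
Qed.

Lemma step_eq_trans x y z : step_eq x y -> step_eq y z -> step_eq x z.
Proof.
case=> xy _ Nxy [yz Bz Nyz]; split=> //; first by rewrite xy.
by rewrite -(subrK y.1 x.1) -addrA; apply: generatedD.
Qed.

Lemma step_proper i y z : nzidx n i -> step_eq y z -> step_eq (step i y) (step i z).
Proof.
case: y z => [y b] [z c] ni [/= -> Bc Nyz]; split=> //=; first exact: spanB_Xop.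
by rewrite scalerBD; apply: generatedZ.
Qed.

Lemma step_comm i j z : nzidx n i -> nzidx n j -> step_eq z z ->
  step_eq (step i (step j z)) (step j (step i z)).
Proof.
case: z => [q b] ni nj [/= _ Bb _]; split=> /=; first exact: Xop_comm.
  by do 2!apply: spanB_Xop => //.
rewrite phi_commutator; exact: phi_span.
Qed.

Lemma step_inv i z : nzidx n i -> step_eq z z -> step_eq (step i (step (- i) z)) z.
Proof.
case: z => [q b] ni [/= _ Bb _]; split=> //=; first exact: Xop_inv.
rewrite rho_cancel; last by rewrite monoM xexpNr.
exact: rho_span.
Qed.

Lemma spanB_1 : spanB 1.
Proof. by apply: spanB_mono; case: B_connected. Qed.

(* Its boundary is x^a - sigma(x^a), accumulated along a path from 1 to x^a. *)
Definition walk (a : 'rV[int]_n) : Q := (zact step (enum 'I_n) a (0, 1)).1.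

Lemma walk_snd a : (zact step (enum 'I_n) a (0, 1)).2 = sigma_mono pi a.
Proof.
rewrite /sigma_mono; elim: (enum 'I_n) => // k s IHs; rewrite zactE /zpow /= -IHs.
by elim: `|_|%N => //= m ->.
Qed.

Lemma walk_xexpD i a : nzidx n i ->
  sigma_mono pi (xexp n i + a) = Xop pi i (sigma_mono pi a)
  /\ N (walk (xexp n i + a) - (xvar K n i *: walk a + Yext B i (sigma_mono pi a))).
Proof.
move=> ni.
have R01 : step_eq (0, 1) (0, 1).
  by split=> //=; [exact: spanB_1|rewrite subrr; exact: generated0].
have [] := zactD step_eq_sym step_eq_trans step_proper step_comm step_inv a ni R01.
by rewrite -!walk_snd => -> _ Na.
Qed.

Definition homotopy : S -> Q := kext walk.

Lemma sigma_xvarM i p : nzidx n i -> sigma pi (xvar K n i * p) = Xop pi i (sigma pi p).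
Proof.
move=> ni; elim/laurent_ind: p => [|c a q IH]; first by rewrite mulr0 sigma0 Xop0.
rewrite mulrDr -scalerAr !sigma_linear IH Xop_linear //; try exact: spanB_sigma.
by rewrite monoM !sigma_monoE; have [->] := walk_xexpD a ni.
Qed.

Lemma homotopy_xvarM i p : nzidx n i ->
  N (homotopy (xvar K n i * p) - (xvar K n i *: homotopy p + Yext B i (sigma pi p))).
Proof.
move=> ni; rewrite /homotopy YextE.
elim/laurent_ind: p => [|c a q IH].
  by rewrite mulr0 sigma0 !kext0 scaler0 addr0 subrr; exact: generated0.
rewrite mulrDr -scalerAr sigma_linear !kext_linear rho_defect_linear.
apply: generatedD IH; apply: generatedZ.
rewrite monoM !kext_mono sigma_monoE -YextE.
by have [_] := walk_xexpD a ni.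
Qed.

Lemma homotopy_inside b : spanB b -> N (homotopy b).
Proof.
elim/generated_ind: b / => [|c _ v [m Bm ->] Bv IH].
  by rewrite /homotopy kext0; exact: generated0.
rewrite /homotopy kext_linear; apply: generatedD IH; apply: generatedZ.
rewrite kext_mono; elim: {m}(ldeg m).+1 {-2}m (ltnSn (ldeg m)) Bm => // d IHd m md Bm.
have [->|m0] := eqVneq m 0; first by rewrite /walk zact0; exact: generated0.
have [i [m' [ni Bm' mE lt_m'm]]] := B_connected.2 m Bm m0.
have Nm' : N (walk m') by apply: IHd => //; apply: leq_trans lt_m'm _.
have [_] := walk_xexpD m' ni; rewrite -mE -sigma_monoE sigma_id; last exact: spanB_mono.
rewrite YextE kext_mono Ysym_inside -?mE // addr0 => Nm.
by rewrite -(subrK (xvar K n i *: walk m') (walk m)); apply/generatedD/generatedZ.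
Qed.

Lemma homotopy_psi i m : nzidx n i -> m \in B ->
  N (homotopy (psi pi i (mono K m)) - Y i m).
Proof.
move=> ni Bm; have Bmm := spanB_mono Bm.
have := homotopy_xvarM (mono K m) ni.
rewrite sigma_id // YextE kext_mono => N1.
have N2 := generatedZ (xvar K n i) (homotopy_inside Bmm).
have N3 := homotopy_inside (spanB_Xop ni Bmm).
have -> : psi pi i (mono K m) = (-1) *: Xop pi i (mono K m) + xvar K n i * mono K m.
  by rewrite scaleN1r addrC.
rewrite /homotopy kext_linear -addrA; apply: generatedD; first exact: generatedZ.
by rewrite -(subrDK _ (xvar K n i *: homotopy (mono K m))); apply: generatedD.
Qed.

Lemma homotopy_monoM a f : sigma pi f = 0 ->
  sigma pi (mono K a * f) = 0 /\
  N (homotopy (mono K a * f) - mono K a *: homotopy f).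
Proof.
elim/(@xexp_ind n): a f => [|a b IHa IHb|i ni] f f0.
- by rewrite mul1r f0 scale1r subrr; split=> //; exact: generated0.
- rewrite -monoM -mulrA -scalerA; have [bf0 Nb] := IHb _ f0.
  have [abf0 Na] := IHa _ bf0; split; first exact: abf0.
  rewrite (subr_insert _ (homotopy (mono K b * f))).
  exact: generatedD Na (generatedZ (mono K a) Nb).
- split; first by rewrite sigma_xvarM // f0 Xop0.
  by have := homotopy_xvarM f ni; rewrite f0 YextE kext0 addr0.
Qed.

Lemma homotopyM p f : sigma pi f = 0 -> N (homotopy (p * f) - p *: homotopy f).
Proof.
move=> f0; elim/laurent_ind: p => [|c a q IH].
  by rewrite mul0r scale0r subr0 /homotopy kext0; exact: generated0.
rewrite mulrDl -scalerAl /homotopy kext_linear -/homotopy.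
have -> : (c *: mono K a + q) *: homotopy f =
          c%:A *: (mono K a *: homotopy f) + q *: homotopy f.
  by rewrite scalerDl scalerA mulr_algl.
rewrite scalerDB; apply: generatedD IH; apply: generatedZ.
by have [_] := homotopy_monoM a f0.
Qed.

Lemma homotopyK g : N (homotopy (partial1 B pi g) - g).
Proof.
rewrite [g]monalgE; elim: (enum_fset _) => [|k s IHs].
  by rewrite !big_nil (raddf0 (partial1 B pi)) /homotopy kext0 subr0; exact: generated0.
rewrite !big_cons; set u := \sum_(_ <- s) _ in IHs *.
have /and3P[ni Bm _] := valP k.
set p := g@_k; set f := psi pi (val k).1 (mono K (val k).2).
have gE : << p *g k >> = p *: Y (val k).1 (val k).2 :> Q.
  by rewrite Ysym_val; exact: malgU_scale.
have -> : partial1 B pi (<< p *g k >> + u) = p * f + partial1 B pi u.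
  by rewrite (raddfD (partial1 B pi)); congr (_ + _); exact: linextU.
have f0 : sigma pi f = 0.
  by rewrite -[f]mul1r; apply: (sigma_psi 0) => //; exact: spanB_mono.
rewrite /homotopy kextD gE.
have N1 := homotopyM p f0.
have N2 := generatedZ p (homotopy_psi ni Bm).
rewrite (subr_split p (homotopy f)); apply: generatedD IHs; exact: generatedD.
Qed.

End BorderBasisSyzygies.

Theorem theorem3p6 (K : fieldType) (n : nat) (B : {fset 'rV[int]_n})
    (pi : laurent K n -> laurent K n)
    (B_connected : connected_to_1 B)
    (pi_projection : border_projection B pi)
    (F_border_basis : border_basis_in_any_degree B pi) :
  forall g : syz_module K B,
    partial1 B pi g = 0 <-> generated (basic_syzygy pi (B := B)) g.
Proof.
move=> g; split=> [g0|].
  have := homotopyK B_connected pi_projection F_border_basis g.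
  by rewrite g0 /homotopy kext0 sub0r => /generatedN; rewrite opprK.
elim/generated_ind: g / => [|c u v Gu _ IH]; first exact: raddf0.
by rewrite linearP IH addr0 partial1_basic // scaler0.
Qed.
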